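(* Let $J:\mathrm{Diff}(S^1)\to\mathrm{Map}(S^1,\mathbb{R}^* )$, $F\mapsto F^J$, be the jacobian map. The Virasoro-Bott cocycle $B$ on $\mathrm{Diff}(S^1)$ is obtained by evaluating the Heisenberg cocycle $C$ on $F^J(G)$ and $G^J$: $$B(F,G)=C\bigl(F^J(G),\,G^J\bigr)\qquad\text{for all } F,G\in\mathrm{Diff}(S^1).$$
   Context: $S^1=\mathbb{R}/\mathbb{Z}$ with coordinate $t$. $\mathrm{Diff}(S^1)$ is the group of $C^\infty$ diffeomorphisms of $S^1$ under composition. $\mathrm{Map}(S^1,\mathbb{R}^* )$ is the group, under pointwise multiplication, of $C^\infty$ maps from $S^1$ to $\mathbb{R}^*=\mathbb{R}\setminus\{0\}=GL_1(\mathbb{R})$. The jacobian $F^J$ of $F\in\mathrm{Diff}(S^1)$ is its derivative $F^J(t)=F'(t)$ with respect to the coordinate $t$ (computed via a lift of $F$ to $\mathbb{R}$), a nowhere vanishing smooth function on $S^1$. $\mathrm{Diff}(S^1)$ acts on $\mathrm{Map}(S^1,\mathbb{R}^* )$ by $m(G)(t)=m(G(t))$, so $F^J(G)$ is the function $t\mapsto F'(G(t))$. The Virasoro-Bott cocycle is the map $B:\mathrm{Diff}(S^1)\times\mathrm{Diff}(S^1)\to\mathbb{R}$, $$B(F,G)=\int_0^1\ln|F'(G(t))|\;d\ln|G'(t)|.$$ The Heisenberg cocycle is the map $C:\mathrm{Map}(S^1,\mathbb{R}^* )\times\mathrm{Map}(S^1,\mathbb{R}^* )\to\mathbb{R}$,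 $$C(f,g)=\int_{S^1}\ln|f|\;d\ln|g|.$$ *)

(* Defs.v *)
From HB Require Import structures.
From mathcomp Require Import all_boot all_order all_algebra.
From mathcomp Require Import generic_quotient.
From mathcomp Require Import all_classical all_reals all_analysis.
Set Implicit Arguments.
Unset Strict Implicit.
Unset Printing Implicit Defensive.
Import Order.TTheory GRing.Theory Num.Theory.
Import numFieldNormedType.Exports.
Local Open Scope ring_scope.
Local Open Scope classical_set_scope.
Local Open Scope quotient_scope.

(* Within ring_scope these notations otherwise mean the formal derivatives of a
   polynomial. *)
Local Notation "f ^` ()" := (derive1 f) : ring_scope.
Local Notation "f ^` ( n )" := (derive1n n f) : ring_scope.

Section SmoothReal.
Variable R : realType.
Implicit Types (f g : R -> R).

Definition smooth f : Prop := forall (n : nat) (x : R), derivable f^`(n) x 1.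

(* [n_diff n f] : f is n+1 times differentiable; used only for inductions. *)
Fixpoint n_diff (n : nat) f : Prop :=
  (forall x, derivable f x 1) /\ (if n is m.+1 then n_diff m f^`() else True).

Lemma n_diff0 n f : n_diff n f -> forall x, derivable f x 1.
Proof. by case: n => [|n] []. Qed.

Lemma n_diffW n f : n_diff n.+1 f -> n_diff n f.
Proof.
elim: n f => [|n IH] f; first by move=> [df _]; split.
by move=> [df d2f]; split => //; exact: IH.
Qed.

Lemma smoothP f : smooth f <-> forall n, n_diff n f.
Proof.
split=> [sf n|sf n].
  elim: n f sf => [|n IH] f sf; first by split=> // x; exact: (sf 0%N).
  split; first by move=> x; exact: (sf 0%N).
  by apply: IH => m x; move: (sf m.+1 x); rewrite /derive1n iterSr.
elim: n f sf => [|n IH] f sf x; first exact: (n_diff0 (sf 0%N)).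
by rewrite /derive1n iterSr; apply: IH => m; case: (sf m.+1).
Qed.

Lemma smooth_derivable f x : smooth f -> derivable f x 1.
Proof. by move=> /(_ 0%N x). Qed.

Lemma smooth_derive f : smooth f -> smooth f^`().
Proof. by move=> sf n x; move: (sf n.+1 x); rewrite /derive1n iterSr. Qed.

Lemma n_diff_cst n (c : R) : n_diff n (fun=> c).
Proof.
elim: n c => [|n IH] c; split=> //.
rewrite (_ : _^`() = fun=> 0 : R); first exact: IH.
by apply/funext => x; rewrite derive1_cst.
Qed.

Lemma smooth_cst (c : R) : smooth (fun=> c).
Proof. by apply/smoothP => n; exact: n_diff_cst. Qed.

Lemma smooth_shift (c : R) : smooth (fun x => x + c).
Proof.
have d x : derivable (fun x : R => x + c) x 1 by [].
apply/smoothP => -[|n]; split=> //.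
rewrite (_ : _^`() = fun=> 1 : R); first exact: n_diff_cst.
apply/funext => y; rewrite derive1E deriveD// derive_cst addr0.
exact: derive_id.
Qed.

Lemma smooth_id : smooth (@id R).
Proof.
rewrite (_ : id = fun x : R => x + 0); first exact: smooth_shift.
by apply/funext => x /=; rewrite addr0.
Qed.

Lemma n_diffD n f g : n_diff n f -> n_diff n g -> n_diff n (fun x => f x + g x).
Proof.
elim: n f g => [|n IH] f g hf hg.
  by split=> // x; apply: derivableD; [exact: (n_diff0 hf)|exact: (n_diff0 hg)].
have df := n_diff0 hf; have dg := n_diff0 hg.
split; first by move=> x; apply: derivableD.
rewrite (_ : _^`() = fun x => f^`() x + g^`() x); last first.
  by apply/funext => x; rewrite !derive1E deriveD.
by apply: IH; [case: hf|case: hg].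
Qed.

Lemma n_diffM n f g : n_diff n f -> n_diff n g -> n_diff n (fun x => f x * g x).
Proof.
elim: n f g => [|n IH] f g hf hg.
  by split=> // x; apply: derivableM; [exact: (n_diff0 hf)|exact: (n_diff0 hg)].
have df := n_diff0 hf; have dg := n_diff0 hg.
split; first by move=> x; apply: derivableM.
rewrite (_ : _^`() = fun x => f x * g^`() x + g x * f^`() x); last first.
  by apply/funext => x; rewrite !derive1E deriveM.
case: (hf) => _ hf'; case: (hg) => _ hg'.
by apply: n_diffD; [exact: IH (n_diffW hf) hg'|exact: IH (n_diffW hg) hf'].
Qed.

Lemma n_diff_comp n f g : n_diff n f -> n_diff n g -> n_diff n (f \o g).
Proof.
have dc f1 g1 : (forall x, derivable f1 x 1) -> (forall x, derivable g1 x 1) ->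
    forall x, derivable (f1 \o g1) x 1.
  move=> df dg x; apply/derivable1_diffP/differentiable_comp;
    exact/derivable1_diffP.
elim: n f g => [|n IH] f g hf hg.
  by split=> //; apply: dc; [exact: (n_diff0 hf)|exact: (n_diff0 hg)].
have df := n_diff0 hf; have dg := n_diff0 hg.
split; first exact: dc.
rewrite (_ : _^`() = fun x => (f^`() \o g) x * g^`() x); last first.
  by apply/funext => x; rewrite derive1_comp.
by apply: n_diffM; [apply: IH; [case: hf|exact: n_diffW]|case: hg].
Qed.

Lemma n_diffV n f : (forall x, f x != 0) -> n_diff n f ->
  n_diff n (fun x => (f x)^-1).
Proof.
move=> f0; have dv : (forall x, derivable f x 1) ->
    forall x, derivable (fun x => (f x)^-1) x 1.
  by move=> df x; exact: derivableV.
elim: n => [|n IH] hf; first by split=> //; apply: dv; exact: (n_diff0 hf).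
split; first by apply: dv; exact: (n_diff0 hf).
rewrite (_ : _^`() = fun x => (-1) * ((f x)^-1 * (f x)^-1) * f^`() x); last first.
  apply/funext => x; rewrite !derive1E deriveV//; last exact: (n_diff0 hf).
  by rewrite -[_ *: _]/(_ * _) mulN1r -exprVn expr2.
apply: n_diffM; last by case: hf.
apply: n_diffM; first exact: n_diff_cst.
by apply: n_diffM; apply: IH; exact: n_diffW.
Qed.

Lemma smoothM f g : smooth f -> smooth g -> smooth (fun x => f x * g x).
Proof. by move=> /smoothP sf /smoothP sg; apply/smoothP => n; exact: n_diffM. Qed.

Lemma smooth_comp f g : smooth f -> smooth g -> smooth (f \o g).
Proof.
by move=> /smoothP sf /smoothP sg; apply/smoothP => n; exact: n_diff_comp.
Qed.

Lemma smoothV f : (forall x, f x != 0) -> smooth f -> smooth (fun x => (f x)^-1).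
Proof. by move=> f0 /smoothP sf; apply/smoothP => n; exact: n_diffV. Qed.

End SmoothReal.

Section Circle.
Variable R : realType.

Definition eqmodZ (x y : R) : bool := x - y \is a Num.int.

Lemma eqmodZ_equiv : equiv_class_of eqmodZ.
Proof.
split=> [x|x y|y x z]; rewrite /eqmodZ.
- by rewrite subrr rpred0.
- by rewrite -opprB rpredN.
- by move=> xy yz; rewrite -(subrK y x) -addrA rpredD.
Qed.

Canonical eqmodZ_equiv_rel : equiv_rel R := EquivRelPack eqmodZ_equiv.

(* The circle R/Z; [\pi_S1 x] is the class of x modulo Z. *)
Definition S1 : Type := {eq_quot eqmodZ_equiv_rel}.
HB.instance Definition _ := Choice.on S1.
HB.instance Definition _ := EqQuotient.on S1.

Lemma eqS1P (x y : R) : (\pi_S1 x = \pi_S1 y) <-> x - y \is a Num.int.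
Proof.
by split=> [/eqP|xy]; [|apply/eqP]; rewrite /S1 (@eqmodE _ eqmodZ_equiv_rel).
Qed.

Lemma S1_ind (P : S1 -> Prop) : (forall x : R, P (\pi_S1 x)) -> forall t, P t.
Proof. by move=> hP t; rewrite -[t]reprK; exact: hP. Qed.

Definition is_lift (F : S1 -> S1) (f : R -> R) : Prop :=
  forall x, F (\pi_S1 x) = \pi_S1 (f x).

(* As x |-> \pi_S1 x is the universal covering of the circle, a map of S^1 is
   smooth iff it lifts to a smooth function on the line. *)
Definition smooth_S1_S1 (F : S1 -> S1) : Prop :=
  exists2 f : R -> R, smooth f & is_lift F f.

Definition smooth_S1_R (m : S1 -> R) : Prop := smooth (m \o \pi_S1).

Lemma derive1_lift_uniq (F : S1 -> S1) (f g : R -> R) :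
  smooth f -> smooth g -> is_lift F f -> is_lift F g -> f^`() = g^`().
Proof.
move=> sf sg lf lg; apply/funext => x; rewrite !derive1E.
have df := smooth_derivable (x := x) sf; have dg := smooth_derivable (x := x) sg.
apply/eqP; rewrite -subr_eq0 -deriveB //; apply/eqP.
pose h := f \- g.
have hint y : h y \is a Num.int by apply/eqS1P; rewrite -lf -lg.
have ch : {for x, continuous h}.
  apply: differentiable_continuous; apply/derivable1_diffP; exact: derivableB.
rewrite (@near_eq_derive _ _ _ _ (fun=> h x) x); first exact: derive_cst.
have /cvgrPdist_lt/(_ 1 ltr01) := ch.
apply: filterS => y hy.
have : h x - h y \is a Num.int by rewrite rpredB.
move=> /intrP[k hk]; apply/eqP; rewrite eq_sym -subr_eq0 hk.
move: hy; rewrite hk -intr_norm -[1]/(1%:~R) ltr_int.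
by case: k {hk} => [[|k]|k].
Qed.

(* Diff(S^1), a group under composition. *)
Record diffS1 := DiffS1 {
  diff_fun :> S1 -> S1;
  diff_smooth : smooth_S1_S1 diff_fun;
  diff_inv : exists2 G, smooth_S1_S1 G & cancel diff_fun G /\ cancel G diff_fun }.

(* Map(S^1, R^* ), a group under pointwise multiplication. *)
Record mapS1 := MapS1 {
  map_fun :> S1 -> R;
  map_smooth : smooth_S1_R map_fun;
  map_neq0 : forall t, map_fun t != 0 }.

Lemma diffS1_eq (F G : diffS1) : F =1 G -> F = G.
Proof.
case: F G => [F sF iF] [G sG iG] /= /funext FG.
by case: _ / FG sG iG => sG iG; congr DiffS1; exact: Prop_irrelevance.
Qed.

Lemma mapS1_eq (m n : mapS1) : m =1 n -> m = n.
Proof.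
case: m n => [m sm m0] [n sn n0] /= /funext mn.
by case: _ / mn sn n0 => sn n0; congr MapS1; exact: Prop_irrelevance.
Qed.

Lemma smooth_S1_S1_id : smooth_S1_S1 id.
Proof. by exists id => //; exact: smooth_id. Qed.

Lemma smooth_S1_S1_comp F G :
  smooth_S1_S1 F -> smooth_S1_S1 G -> smooth_S1_S1 (F \o G).
Proof.
move=> [f sf lf] [g sg lg]; exists (f \o g); first exact: smooth_comp.
by move=> x /=; rewrite lg lf.
Qed.

Lemma smooth_S1_R_comp m G :
  smooth_S1_R m -> smooth_S1_S1 G -> smooth_S1_R (m \o G).
Proof.
move=> sm [g sg lg]; rewrite /smooth_S1_R.
rewrite (_ : _ \o _ = (m \o \pi_S1) \o g); first exact: smooth_comp.
by apply/funext => x /=; rewrite lg.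
Qed.

Definition diff1 : diffS1.
Proof.
exists id; first exact: smooth_S1_S1_id.
by exists id => //; exact: smooth_S1_S1_id.
Defined.

Definition diff_comp (F G : diffS1) : diffS1.
Proof.
exists (F \o G); first by apply: smooth_S1_S1_comp; exact: diff_smooth.
have [F' sF' [FK F'K]] := diff_inv F; have [G' sG' [GK G'K]] := diff_inv G.
exists (G' \o F'); first exact: smooth_S1_S1_comp.
by split; exact: can_comp.
Defined.

Definition diffV (F : diffS1) : diffS1.
Proof.
exists (s2val (cid2 (diff_inv F))); first by case: cid2.
by case: cid2 => G sG [FK GK]; exists F; first exact: diff_smooth.
Defined.

Lemma diffVK (F : diffS1) : cancel F (diffV F) /\ cancel (diffV F) F.
Proof. by rewrite /diffV /=; case: cid2 => G sG []. Qed.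

HB.instance Definition _ := gen_eqMixin diffS1.
HB.instance Definition _ := gen_choiceMixin diffS1.

Lemma diff_compA : associative diff_comp.
Proof. by move=> F G H; exact: diffS1_eq. Qed.
Lemma diff_comp1l : left_id diff1 diff_comp.
Proof. by move=> F; exact: diffS1_eq. Qed.
Lemma diff_comp1r : right_id diff1 diff_comp.
Proof. by move=> F; exact: diffS1_eq. Qed.
Lemma diff_compVl : left_inverse diff1 diffV diff_comp.
Proof. by move=> F; apply: diffS1_eq => t; case: (diffVK F) => FK _; exact: FK. Qed.
Lemma diff_compVr : right_inverse diff1 diffV diff_comp.
Proof. by move=> F; apply: diffS1_eq => t; case: (diffVK F) => _ FK; exact: FK. Qed.

HB.instance Definition _ := isGroup.Build diffS1
  diff_compA diff_comp1l diff_comp1r diff_compVl diff_compVr.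

Definition map1 : mapS1.
Proof. by exists (fun=> 1); [exact: smooth_cst|move=> t; exact: oner_neq0]. Defined.

Definition map_mul (m n : mapS1) : mapS1.
Proof.
exists (fun t => m t * n t).
  by apply: (@smoothM _ (m \o \pi_S1) (n \o \pi_S1)); exact: map_smooth.
by move=> t; rewrite mulf_neq0 ?map_neq0.
Defined.

Definition map_inv (m : mapS1) : mapS1.
Proof.
exists (fun t => (m t)^-1).
  apply: (@smoothV _ (m \o \pi_S1)); last exact: map_smooth.
  by move=> x; exact: map_neq0.
by move=> t; rewrite invr_eq0 map_neq0.
Defined.

HB.instance Definition _ := gen_eqMixin mapS1.
HB.instance Definition _ := gen_choiceMixin mapS1.

Lemma map_mulA : associative map_mul.
Proof. by move=> m n p; apply: mapS1_eq => t /=; rewrite mulrA. Qed.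
Lemma map_mul1l : left_id map1 map_mul.
Proof. by move=> m; apply: mapS1_eq => t /=; rewrite mul1r. Qed.
Lemma map_mul1r : right_id map1 map_mul.
Proof. by move=> m; apply: mapS1_eq => t /=; rewrite mulr1. Qed.
Lemma map_mulVl : left_inverse map1 map_inv map_mul.
Proof. by move=> m; apply: mapS1_eq => t /=; rewrite mulVf ?map_neq0. Qed.
Lemma map_mulVr : right_inverse map1 map_inv map_mul.
Proof. by move=> m; apply: mapS1_eq => t /=; rewrite mulfV ?map_neq0. Qed.

HB.instance Definition _ := isGroup.Build mapS1
  map_mulA map_mul1l map_mul1r map_mulVl map_mulVr.

(* The action m(G) of G : Diff(S^1) on m : Map(S^1, R^* ) *)
Definition pullback (m : mapS1) (G : diffS1) : mapS1.
Proof.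
exists (m \o G); last by move=> t; exact: map_neq0.
by apply: smooth_S1_R_comp; [exact: map_smooth|exact: diff_smooth].
Defined.

(* A chosen smooth lift of F; lifts are unique up to an integer constant. *)
Definition diff_lift (F : diffS1) : R -> R := s2val (cid2 (diff_smooth F)).

Lemma diff_lift_smooth (F : diffS1) : smooth (diff_lift F).
Proof. by rewrite /diff_lift; case: cid2. Qed.

Lemma diff_liftP (F : diffS1) : is_lift F (diff_lift F).
Proof. by rewrite /diff_lift; case: cid2. Qed.

Definition jacobian_fun (F : diffS1) : S1 -> R :=
  fun t => (diff_lift F)^`() (repr t).

(* The jacobian does not depend on the lift, nor on the representative. *)
Lemma jacobian_funE (F : diffS1) (f : R -> R) : smooth f -> is_lift F f ->
  forall x, jacobian_fun F (\pi_S1 x) = f^`() x.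
Proof.
move=> sf lf x; rewrite /jacobian_fun.
rewrite (derive1_lift_uniq (@diff_lift_smooth F) sf (@diff_liftP F) lf).
set y := repr _; have yx : \pi_S1 y = \pi_S1 x by rewrite reprK.
pose g z := f (z + (y - x)).
have sg : smooth g by apply: (smooth_comp sf); exact: smooth_shift.
have lg : is_lift F g.
  move=> z; rewrite -lf; congr (F _); apply/eqS1P.
  by rewrite opprD addrA subrr add0r rpredN; apply/eqS1P.
rewrite [in RHS](derive1_lift_uniq sf sg lf lg) /g.
rewrite -[fun z => _]/(f \o (fun z => z + (y - x))) [RHS]derive1_comp //; last first.
  exact: smooth_derivable.
rewrite /= [x + _]addrC subrK [X in _ * X](_ : _ = 1) ?mulr1 //.
by rewrite derive1E deriveD// derive_cst addr0; exact: derive_id.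
Qed.

Lemma jacobian_smooth (F : diffS1) : smooth_S1_R (jacobian_fun F).
Proof.
rewrite /smooth_S1_R (_ : _ \o _ = (diff_lift F)^`()).
  exact/smooth_derive/diff_lift_smooth.
apply/funext => x /=; apply: jacobian_funE; [exact: diff_lift_smooth|exact: diff_liftP].
Qed.

Lemma jacobian_neq0 (F : diffS1) t : jacobian_fun F t != 0.
Proof.
move: t; apply: S1_ind => x; rewrite (jacobian_funE (@diff_lift_smooth F) (@diff_liftP F)).
have [G [g sg lg] [FK _]] := diff_inv F.
have sgf := smooth_comp sg (@diff_lift_smooth F).
have lgf : is_lift id (g \o diff_lift F) by move=> z /=; rewrite -lg -diff_liftP FK.
have := derive1_lift_uniq sgf (@smooth_id R) lgf (fun=> erefl).
move=> /(congr1 (fun u => u x)); rewrite derive1_comp; first last.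
- exact: smooth_derivable.
- exact/smooth_derivable/diff_lift_smooth.
rewrite [RHS](_ : _ = 1); last by rewrite derive1E; exact: derive_id.
move=> gf1; apply/eqP => f0; move: gf1; rewrite f0 mulr0 => /esym/eqP.
by rewrite oner_eq0.
Qed.

Definition jacobianS1 (F : diffS1) : mapS1 :=
  MapS1 (@jacobian_smooth F) (@jacobian_neq0 F).

(* The integral of u dv over [0, 1], where dv = v'(t) dt. *)
Definition int01 (u v : R -> R) : R :=
  \int[lebesgue_measure]_(t in `[0, 1]) (u t * v^`() t).

(* The integral over S^1 of the 1-form u dv, pulled back to [0, 1]. *)
Definition intS1 (u v : S1 -> R) : R := int01 (u \o \pi_S1) (v \o \pi_S1).

Definition virasoro_bott (F G : diffS1) : R :=
  int01 (fun t => ln `|(diff_lift F)^`() (diff_lift G t)|)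
        (fun t => ln `|(diff_lift G)^`() t|).

(* The Virasoro-Bott cocycle does not depend on the lifts. *)
Lemma virasoro_bottE (F G : diffS1) (f g : R -> R) :
  smooth f -> is_lift F f -> smooth g -> is_lift G g ->
  virasoro_bott F G = int01 (fun t => ln `|f^`() (g t)|) (fun t => ln `|g^`() t|).
Proof.
move=> sf lf sg lg; rewrite /virasoro_bott.
rewrite (derive1_lift_uniq (@diff_lift_smooth G) sg (@diff_liftP G) lg).
suff -> : (fun t => ln `|(diff_lift F)^`() (diff_lift G t)|) =
  (fun t => ln `|f^`() (g t)|) by [].
apply/funext => t.
rewrite -(jacobian_funE (@diff_lift_smooth F) (@diff_liftP F)) -(jacobian_funE sf lf).
by rewrite -diff_liftP -lg.
Qed.

Definition heisenberg (f g : mapS1) : R :=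
  intS1 (fun t => ln `|f t|) (fun t => ln `|g t|).

End Circle.

(* Main.v *)
Require Import Defs.
From mathcomp Require Import all_boot all_order all_algebra all_reals.
From mathcomp Require Import boolp.

Theorem theorem2p1 (R : realType) :
  forall F G : diffS1 R,
    virasoro_bott F G = heisenberg (pullback (jacobianS1 F) G) (jacobianS1 G).
Proof.
move=> F G.
(* Crux: the jacobian, evaluated on the circle through [repr], agrees at [\pi x] with the derivative
   of the chosen lift at every real [x]. *)
have JE (H : diffS1 R) x :=
  jacobian_funE (@diff_lift_smooth R H) (@diff_liftP R H) x.
apply: (f_equal2 (@int01 R)); apply: funext => x.
(* The lift property turns [\pi (diff_lift G x)] into [G (\pi x)], which is the pullback by [G]. *)
- by rewrite -JE -(@diff_liftP R G x).
- by rewrite -JE.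
Qed.
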